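(* Let $\mathcal{M}$ be a Markov chain on state space $\Omega$. Let $\mathrm{d}$ be an integer valued metric on $\Omega$, and let $(X_t,Y_t)$ be a path coupling for $\mathcal{M}$ with respect to a set of pairs $S\subseteq\Omega\times\Omega$. For $(X_t,Y_t)\in S$ let $T_t$ be the smallest $t'>t$ such that $\mathrm{d}(X_{t'},Y_{t'})\neq \mathrm{d}(X_t,Y_t)$. Suppose that for some positive integer $k$, some $p>0$ and some constant $\alpha>0$, for all $(X_0,Y_0)\in S$: (i) $\Pr[T_0\le k]\ge p$, and (ii) $\mathbb{E}[\mathrm{d}(X_{T_0},Y_{T_0})/\mathrm{d}(X_0,Y_0)]\le \alpha<1$. Then the mixing time $\tau(\varepsilon)$ of $\mathcal{M}$ satisfies $$\tau(\varepsilon)\le \frac{k(2-\alpha)}{p(1-\alpha)}\ln\Big(\frac{2eD}{\varepsilon}\Big),$$ where $D=\max\{\mathrm{d}(X,Y): X,Y\in\Omega\}$.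
   Context: $\mathcal{M}$ is a discrete-time, time-homogeneous Markov chain on a discrete state space $\Omega$. The mixing time $\tau(\varepsilon)$ (for $0<\varepsilon<1$) is the least $t$ such that, from every starting state, the law of the chain at every time $t'\ge t$ is within total variation distance $\varepsilon$ of the equilibrium distribution. Path coupling setting: $S\subseteq\Omega\times\Omega$ is a set of pairs of distinct states such that any two states $X,Y\in\Omega$ are joined by a path $X=Z^0,Z^1,\dots,Z^r=Y$ with $(Z^i,Z^{i+1})\in S$ for all $i$, and $\mathrm{d}(X,Y)$ is the minimum over such paths of $\sum_i \mathrm{d}(Z^i,Z^{i+1})$. A path coupling $(X_t,Y_t)$ is a Markovian coupling of two copies of $\mathcal{M}$ whose one-step transitions are specified for pairs in $S$ and extended to all pairs by composing the couplings of consecutive pairs along a path of pairs in $S$; states that are equal stay equal. For the stopping times $T_t$ above it is assumed that if $(X_t,Y_t)\in S$ and $t<t'<T_t$, then $(X_{t'},Y_{t'})\in S$ (pairs stay in $S$ until their distance changes). *)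

(* Defs.v *)
From HB Require Import structures.
From mathcomp Require Import all_boot all_order all_algebra.
From mathcomp Require Import all_classical all_reals all_analysis.

Set Implicit Arguments.
Unset Strict Implicit.
Unset Printing Implicit Defensive.

Import Order.TTheory GRing.Theory Num.Theory.
Import numFieldNormedType.Exports.

Local Open Scope classical_set_scope.
Local Open Scope ring_scope.

Definition is_distr (R : realType) (E : countType) (mu : E -> R) : Prop :=
  (forall x, 0 <= mu x) /\ \esum_(x in [set: E]) (mu x)%:E = 1%E.

Definition is_kernel (R : realType) (E : countType) (P : E -> E -> R) : Prop :=
  forall x, is_distr (P x).

Definition is_equilibrium (R : realType) (E : countType)
    (P : E -> E -> R) (pi : E -> R) : Prop :=
  is_distr pi /\
  forall y, \esum_(x in [set: E]) (pi x * P x y)%:E = (pi y)%:E.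

Fixpoint law_at (R : realType) (E : countType) (P : E -> E -> R)
    (x : E) (t : nat) : E -> R :=
  if t is s.+1 then
    fun y => fine (\esum_(z in [set: E]) (law_at P x s z * P z y)%:E)
  else fun y => (x == y)%:R.

Definition tv_dist (R : realType) (E : countType) (mu nu : E -> R) : \bar R :=
  ((2^-1)%:E * \esum_(x in [set: E]) `|mu x - nu x|%:E)%E.

Definition mixed_from (R : realType) (E : countType) (P : E -> E -> R)
    (pi : E -> R) (eps : R) (t : nat) : Prop :=
  forall t', (t <= t')%N -> forall x, (tv_dist (law_at P x t') pi <= eps%:E)%E.

Definition is_mixing_time (R : realType) (E : countType) (P : E -> E -> R)
    (pi : E -> R) (eps : R) (tau : nat) : Prop :=
  mixed_from P pi eps tau /\
  forall t, mixed_from P pi eps t -> (tau <= t)%N.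

Definition is_metric (E : countType) (d : E -> E -> nat) : Prop :=
  [/\ forall x y, d x y = 0%N <-> x = y,
      forall x y, d x y = d y x &
      forall x y z, (d x z <= d x y + d y z)%N].

Definition is_diameter (E : countType) (d : E -> E -> nat) (D : nat) : Prop :=
  (forall x y, (d x y <= D)%N) /\ exists x y, d x y = D.

(* [p] lists the states after [x]; the empty path joins [x] to itself. *)
Definition joins (E : countType) (S : set (E * E)) (x y : E) (p : seq E) : Prop :=
  path [rel u v | (u, v) \in S] x p /\ last x p = y.

Fixpoint path_length (E : countType) (d : E -> E -> nat) (x : E) (p : seq E) : nat :=
  if p is y :: q then (d x y + path_length d y q)%N else 0%N.

Definition is_path_metric (E : countType) (S : set (E * E))
    (d : E -> E -> nat) : Prop :=
  forall x y,
    (exists2 p, joins S x y p & path_length d x p = d x y) /\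
    (forall p, joins S x y p -> (d x y <= path_length d x p)%N).

Definition is_coupling (R : realType) (E : countType)
    (q : E * E -> R) (mu nu : E -> R) : Prop :=
  [/\ is_distr q,
      forall x, \esum_(y in [set: E]) (q (x, y))%:E = (mu x)%:E &
      forall y, \esum_(x in [set: E]) (q (x, y))%:E = (nu y)%:E].

(* Joint law of the first and last coordinates of (Z'_0, .., Z'_r), where
   x = Z_0, .., Z_r is the path: (Z'_0, Z'_1) is drawn from Q (Z_0, Z_1), then
   each Z'_(i+1) from Q (Z_i, Z_(i+1)) conditioned on Z'_i.  The quotient by
   P y v is this conditioning; when P y v = 0 the numerator vanishes and the
   term is 0. *)
Fixpoint compose_along (R : realType) (E : countType) (P : E -> E -> R)
    (Q : E * E -> E * E -> R) (x : E) (p : seq E) : E * E -> R :=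
  if p is y :: q then
    fun u => fine (\esum_(v in [set: E])
      (Q (x, y) (u.1, v) * compose_along P Q y q (v, u.2) / P y v)%:E)
  else fun u => (u.1 == u.2)%:R * P x u.1.

(* [Q] is the one-step kernel of the pair.  It is unconstrained on [S] beyond
   being a coupling; on the diagonal the empty path is used, so that equal
   states stay equal. *)
Definition is_path_coupling (R : realType) (E : countType) (P : E -> E -> R)
    (S : set (E * E)) (Q : E * E -> E * E -> R) : Prop :=
  [/\ forall x y, is_coupling (Q (x, y)) (P x) (P y),
      forall x, Q (x, x) =1 compose_along P Q x [::] &
      forall x y, x <> y -> ~ S (x, y) ->
        exists2 p, joins S x y p & Q (x, y) =1 compose_along P Q x p].

Definition is_markov_chain (R : realType) (E : countType) (K : E -> E -> R)
    (z0 : E) (disp : measure_display) (T : measurableType disp)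
    (Pr : probability T R) (Z : nat -> T -> E) : Prop :=
  [/\ forall n z, measurable [set w | Z n w = z],
      Pr [set w | Z 0%N w = z0] = 1%E &
      forall n (z : nat -> E),
        (Pr [set w | forall i, (i <= n.+1)%N -> Z i w = z i] =
         Pr [set w | forall i, (i <= n)%N -> Z i w = z i]
           * (K (z n) (z n.+1))%:E)%E].

(* The stopping time T_t on the sample point [w]; [None] stands for infinity. *)
Definition change_time (E : countType) (d : E -> E -> nat) (T : Type)
    (X Y : nat -> T -> E) (t : nat) (w : T) : option nat :=
  match pselect (exists n,
      (t < n)%N && (d (X n w) (Y n w) != d (X t w) (Y t w))) with
  | left ex => Some (ex_minn ex)
  | right _ => None
  end.

Definition time_le (o : option nat) (k : nat) : bool :=
  if o is Some n then (n <= k)%N else false.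

Definition stays_until_change (R : realType) (E : countType) (S : set (E * E))
    (d : E -> E -> nat) (disp : measure_display) (T : measurableType disp)
    (Pr : probability T R) (X Y : nat -> T -> E) : Prop :=
  {ae Pr, forall w, forall t t', S (X t w, Y t w) -> (t < t')%N ->
     ~~ time_le (change_time d X Y t w) t' -> S (X t' w, Y t' w)}.

(* d(X_{T_0}, Y_{T_0}) / d(X_0, Y_0), with value 0 where T_0 is infinite. *)
Definition change_ratio (R : realType) (E : countType) (d : E -> E -> nat)
    (T : Type) (X Y : nat -> T -> E) (w : T) : R :=
  if change_time d X Y 0 w is Some n
  then (d (X n w) (Y n w))%:R / (d (X 0%N w) (Y 0%N w))%:R else 0.

(* Main.v *)
Require Import Defs.
From HB Require Import structures.
From mathcomp Require Import all_boot all_order all_algebra.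
From mathcomp Require Import all_classical all_reals all_analysis.
From mathcomp Require Import measurable_realfun lra.

Set Implicit Arguments.
Unset Strict Implicit.
Unset Printing Implicit Defensive.

Import Order.TTheory GRing.Theory Num.Theory.
Import numFieldNormedType.Exports.

Local Open Scope classical_set_scope.
Local Open Scope ring_scope.

(** Write [P^t g] for the function [x |-> E_x [g (M_t)]].  The total variation
distance between the law at time [t] and equilibrium is bounded by the
oscillation of [P^t g], uniformly over the functions [g] with values in [0, 1].
Since any ordered pair of states is joined by a path of pairs of [S] that
realises its distance, the increments of [P^t g] only have to be controlled on
[S], and they add up along the path.  So only the coupling of pairs of [S]
matters: once the distance of a pair has changed, a coupled step is never used
again, and the pair is handled by a shortest path joining its two states.

For [z] in [S] let [survival n z] be the probability of [T_0 > n] and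
[jump n z] the expectation of [d (X_T0, Y_T0)] on the event [T_0 <= n], for the
pair started at [z].  Hypotheses (i) and (ii) give [survival k z <= 1 - p]
and [jump n z <= alpha * d z].  Consider the weight
[(1 - alpha) * d z + jump n z], which lies between [(1 - alpha) * d z] and
[d z].  Suppose that [h] increases by at most [C] times the weight along pairs
of [S], hence by at most [C * d] along all pairs.  Run the pair for [k] steps:
a pair that changes its distance costs [C * d (X_T0, Y_T0)], which the jump term
pays for; a pair that keeps it costs [C] times its current weight, of which the
jump term pays all but [C * (1 - alpha) * d z].  Keeping the distance has
probability at most [1 - p], so that [p * (1 - alpha) * d z] is gained, at least
the fraction [p * (1 - alpha)] of the weight.  This is [contraction_block]: each
block of [k] steps multiplies the constant by [1 - p * (1 - alpha)].

It remains to start this recursion.  An arbitrary [g] with values in [0, 1] is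
only known to increase by at most 1, which exceeds the weight by a factor up to
[1 / (1 - alpha)]; removing this factor at the contraction rate would take
[ln (1 / (1 - alpha)) / (p * (1 - alpha))] blocks, too many when [alpha] is
close to 1.  Instead, after [j] blocks a pair whose distance has not changed
contributes at most [survival (j * k) z <= (1 - p) ^ j], and this is below the
first term of the weight as soon as [(1 - p) ^ j <= 1 - alpha] ([burn_in]).
This takes about [ln (1 / (1 - alpha)) / p <= alpha / (p * (1 - alpha))] blocks,
and [ln (D / eps) / (p * (1 - alpha))] more blocks bring the oscillation from
[D] down to [eps]; the constants of the theorem absorb the rounding. *)

(** * Countable sums and averages *)

Section CountableSums.
Context {R : realType}.
Local Open Scope ereal_scope.

Lemma le_esumZl (I : choiceType) (c : R) (a : I -> \bar R) :
  (0 <= c)%R -> (forall i, 0 <= a i) ->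
  \esum_(i in [set: I]) (c%:E * a i) <= c%:E * \esum_(i in [set: I]) a i.
Proof.
move=> c0 a0; apply: ge_ereal_sup => _ [X [finX _] <-].
rewrite -ge0_mule_fsumr// lee_wpmul2l ?lee_fin//.
by apply: ereal_sup_ubound; exists X.
Qed.

Lemma esumZl_fin (I : choiceType) (c : R) (a : I -> \bar R) :
  (0 <= c)%R -> (forall i, 0 <= a i) ->
  \esum_(i in [set: I]) (c%:E * a i) = c%:E * \esum_(i in [set: I]) a i.
Proof.
move=> c0 a0; apply/eqP; rewrite eq_le le_esumZl//=.
have [->|cn0] := eqVneq c 0%R.
  by rewrite mul0e esum_ge0// => i _; rewrite mul0e.
have cgt0 : (0 < c)%R by rewrite lt_def cn0.
rewrite muleC -lee_pdivlMr// muleC.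
rewrite -(@eq_esum _ _ _ (fun i => c^-1%:E * (c%:E * a i))); last first.
  by move=> i _; rewrite muleA -EFinM mulVf// mul1e.
by apply: le_esumZl => [|i]; rewrite ?invr_ge0// mule_ge0.
Qed.

Lemma esumZl (I : choiceType) (c : \bar R) (a : I -> \bar R) :
  0 <= c -> (forall i, 0 <= a i) ->
  \esum_(i in [set: I]) (c * a i) = c * \esum_(i in [set: I]) a i.
Proof.
case: c => [c|_ a0|//]; first exact: esumZl_fin.
have [[i ai]|noa] := pselect (exists i, a i != 0).
  have ai0 : 0 < a i by rewrite lt_def ai a0.
  have ge_term (b : I -> \bar R) : (forall i, 0 <= b i) ->
      b i <= \esum_(i in [set: I]) b i.
    move=> b0; apply: esum_ge; exists [set i]; last by rewrite fsbig_set1.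
    by split; [exact: finite_set1|].
  have -> : +oo * (\esum_(i in [set: I]) a i) = +oo.
    by rewrite gt0_mulye// (lt_le_trans ai0)// ge_term.
  apply/eqP; rewrite -leye_eq -[leLHS](gt0_mulye ai0).
  by apply: (ge_term (fun i => +oo * a i)) => j; rewrite mule_ge0.
have {noa} a_eq0 i : a i = 0.
  by apply/eqP/negPn/negP => ai; apply: noa; exists i.
by rewrite !esum1 ?mule0// => i _; rewrite a_eq0 mule0.
Qed.

Lemma esum_pair (I J : choiceType) (a : I * J -> \bar R) :
  (forall k, 0 <= a k) ->
  \esum_(k in [set: I * J]) a k =
  \esum_(i in [set: I]) \esum_(j in [set: J]) a (i, j).
Proof.
move=> a0; rewrite esum_esum//=.
have -> : [set: I] `*`` (fun=> [set: J]) = [set: I * J].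
  by apply/seteqP; split.
by apply: eq_esum => -[].
Qed.

Lemma esum_exchange (I J : choiceType) (a : I -> J -> \bar R) :
  (forall i j, 0 <= a i j) ->
  \esum_(i in [set: I]) \esum_(j in [set: J]) a i j =
  \esum_(j in [set: J]) \esum_(i in [set: I]) a i j.
Proof.
move=> a0.
rewrite -(esum_pair (a := fun k => a k.1 k.2))//.
rewrite -(esum_pair (a := fun k => a k.2 k.1))//.
rewrite (@reindex_esum _ _ _ [set: J * I] [set: I * J] (fun k => (k.2, k.1)))//.
split=> //; first by move=> [i j] [i' j'] _ _ /= [-> ->].
by move=> [i j] _; exists (j, i).
Qed.

End CountableSums.

Section Averages.
Context {R : realType} {E : choiceType}.
Local Open Scope ereal_scope.

Definition avg (q : E -> R) (f : E -> \bar R) : \bar R :=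
  \esum_(x in [set: E]) ((q x)%:E * f x).

Lemma avg_ge0 q f : (forall x, (0 <= q x)%R) -> (forall x, 0 <= f x) ->
  0 <= avg q f.
Proof. by move=> q0 f0; apply: esum_ge0 => x _; rewrite mule_ge0 ?lee_fin. Qed.

Lemma le_avg q f g : (forall x, (0 <= q x)%R) ->
  (forall x, q x != 0%R -> f x <= g x) -> avg q f <= avg q g.
Proof.
move=> q0 fg; apply: le_esum => x _.
have [->|qx] := eqVneq (q x) 0%R; first by rewrite !mul0e.
by rewrite lee_wpmul2l ?lee_fin ?fg.
Qed.

Lemma avgD q f g : (forall x, (0 <= q x)%R) ->
  (forall x, 0 <= f x) -> (forall x, 0 <= g x) ->
  avg q (fun x => f x + g x) = avg q f + avg q g.
Proof.
move=> q0 f0 g0; rewrite /avg -esumD; last 2 first.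
- by move=> x _; rewrite mule_ge0 ?lee_fin.
- by move=> x _; rewrite mule_ge0 ?lee_fin.
by apply: eq_esum => x _; rewrite ge0_muleDr.
Qed.

Lemma avgZ q c f : (forall x, (0 <= q x)%R) ->
  0 <= c -> (forall x, 0 <= f x) ->
  avg q (fun x => c * f x) = c * avg q f.
Proof.
move=> q0 c0 f0; rewrite /avg -esumZl//; last first.
  by move=> x; rewrite mule_ge0 ?lee_fin.
by apply: eq_esum => x _; rewrite muleCA.
Qed.

End Averages.

Lemma avg_cst (R : realType) (E : countType) (q : E -> R) (c : R) :
  is_distr q -> 0 <= c -> avg q (fun=> c%:E) = c%:E.
Proof.
move=> [q0 q1] c0; rewrite -[RHS]mule1 -q1 -esumZl//.
by apply: eq_esum => x _; rewrite muleC.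
Qed.

Lemma le_avg_cst (R : realType) (E : countType) (q : E -> R) f (c : R) :
  is_distr q -> 0 <= c -> (forall x, f x <= c%:E)%E -> (avg q f <= c%:E)%E.
Proof.
move=> dq c0 fc; rewrite -[leRHS](avg_cst dq c0); apply: le_avg => //.
by case: dq.
Qed.

(** Both marginals are averages over pairs, which is what lets the averages of
one function at two states be compared under a coupling. *)
Lemma avg_coupling (R : realType) (E : countType) (q : E * E -> R) mu nu f :
  is_coupling q mu nu -> (forall x, 0 <= f x)%E ->
  avg q (fun z => f z.1) = avg mu f /\ avg q (fun z => f z.2) = avg nu f.
Proof.
move=> [[q0 _] qmu qnu] f0.
have nn (g : E * E -> \bar R) : (forall z, 0 <= g z)%E ->
    (forall z, 0 <= (q z)%:E * g z)%E.
  by move=> g0 z; rewrite mule_ge0 ?lee_fin.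
split; rewrite /avg esum_pair/=; try exact: nn.
- apply: eq_esum => x _; rewrite -qmu muleC -esumZl//.
    by apply: eq_esum => y _; rewrite muleC.
  by move=> y; rewrite lee_fin.
- rewrite esum_exchange/=; last by move=> x y; exact: (nn (fun z => f z.2)).
  apply: eq_esum => y _; rewrite -qnu muleC -esumZl//.
    by apply: eq_esum => x _; rewrite muleC.
  by move=> x; rewrite lee_fin.
Qed.

(** * Integrals of countably valued variables *)

Section CountablyValuedVariable.
Context {R : realType} {E : countType} {disp : measure_display}.
Context {T : measurableType disp} (mu : {measure set T -> \bar R}).
Variable Z : T -> E.
Hypothesis mZ : forall z, measurable [set w | Z w = z].
Local Open Scope ereal_scope.

Lemma measurable_state (A : set E) : measurable [set w | A (Z w)].
Proof.
have -> : [set w | A (Z w)] = \bigcup_z [set w | A z /\ Z w = z].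
  apply/seteqP; split=> [w Aw|w [z _ [Az Zw]]]; first by exists (Z w).
  by rewrite /= Zw.
apply: countable_bigcupT_measurable => [|z]; first exact: countableP.
have [Az|nAz] := pselect (A z).
  rewrite (_ : [set w | _] = [set w | Z w = z])//.
  by apply/seteqP; split=> w // [].
rewrite (_ : [set w | _] = set0)//.
by apply/seteqP; split=> w // [].
Qed.

Lemma measurable_fun_state (f : E -> \bar R) (D : set T) :
  measurable D -> measurable_fun D (f \o Z).
Proof.
move=> mD _ B mB; apply: measurableI => //.
exact: (measurable_state (f @^-1` B)).
Qed.

(** A countably valued variable reduces integration to a countable sum, so that
the Markov property, given state by state, can be used under an integral. *)
Lemma integral_state (A : set T) (f : E -> \bar R) :
  measurable A -> (forall z, 0 <= f z) ->
  \int[mu]_(w in A) f (Z w) =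
  \esum_(z in [set: E]) (f z * mu (A `&` [set w | Z w = z])).
Proof.
move=> mA f0; pose F n := A `&` [set w | pickle (Z w) = n].
have mF n : measurable (F n).
  by apply: measurableI => //; exact: (measurable_state [set z | pickle z = n]).
have tF : trivIset setT F by move=> i j _ _ [w [[_ /= <-] [_ /= <-]]].
have AE : A = \bigcup_n F n.
  by apply/seteqP; split=> [w Aw|w [n _ []]//]; exists (pickle (Z w)).
rewrite {1}AE ge0_integral_bigcup//; last first.
  exact/measurable_fun_state/bigcupT_measurable.
rewrite nneseries_esumT; last by move=> n; exact: integral_ge0.
transitivity (\esum_(n in range (@pickle E)) \int[mu]_(w in F n) f (Z w)).
  rewrite [RHS]esum_mkcond; apply: eq_esum => n _; case: ifPn => // nr.
  rewrite (_ : F n = set0) ?integral_set0//; apply/seteqP; split=> // w [_ Zw].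
  by move/negP: nr; apply; rewrite inE; exists (Z w).
rewrite esum_image; last by move=> x y _ _; exact: (pcan_inj pickleK).
apply: eq_esum => z _; have -> : F (pickle z) = A `&` [set w | Z w = z].
  congr (_ `&` _); apply/seteqP; split=> w /=; last by move->.
  exact: (pcan_inj pickleK).
rewrite (eq_integral (fun=> f z)) ; last first.
  by move=> w; rewrite inE /= => -[_ ->].
by rewrite integral_cst//; apply: measurableI.
Qed.

Lemma measure_state (A : set T) : measurable A ->
  mu A = \esum_(z in [set: E]) mu (A `&` [set w | Z w = z]).
Proof.
move=> mA; rewrite -[LHS]mul1e -integral_cst//.
rewrite (integral_state (f := fun=> 1) mA)//.
by apply: eq_esum => z _; rewrite mul1e.
Qed.

End CountablyValuedVariable.

(** * The Markov property *)

Section MarkovProperty.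
Context {R : realType} {E : countType} {K : E -> E -> R} {z0 : E}.
Context {disp : measure_display} {T : measurableType disp}.
Context {Pr : probability T R} {Z : nat -> T -> E}.
Hypothesis K0 : forall z z', 0 <= K z z'.
Hypothesis hZ : is_markov_chain K z0 Pr Z.
Local Open Scope ereal_scope.

Definition trajectories (A : nat -> set E) (n : nat) : set T :=
  [set w | forall i, (i <= n)%N -> A i (Z i w)].

Lemma measurable_eq_state n z : measurable [set w | Z n w = z].
Proof. by have [mZ _ _] := hZ. Qed.

Lemma measurable_trajectories A n : measurable (trajectories A n).
Proof.
have mA i : measurable [set w | A i (Z i w)].
  by apply: measurable_state => z; exact: measurable_eq_state.
elim: n => [|n IHn].
  rewrite (_ : trajectories A 0 = [set w | A 0%N (Z 0%N w)])//.
  apply/seteqP; split=> w; first by apply.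
  by move=> Aw i; rewrite leqn0 => /eqP ->.
rewrite (_ : trajectories A n.+1 =
  trajectories A n `&` [set w | A n.+1 (Z n.+1 w)]); first exact: measurableI.
apply/seteqP; split=> w.
  by move=> Aw; split; [move=> i /leqW; exact: Aw|exact: Aw].
by move=> [Aw An] i; rewrite leq_eqVlt ltnS => /predU1P[->|/Aw].
Qed.

(** The constraint that interpolates between the hypothesis on the chain, where
the whole trajectory is prescribed ([m = 0]), and the usual Markov property,
where the past is an arbitrary event and only the present is prescribed. *)
Definition free_then_fixed (A : nat -> set E) (z : nat -> E) m i : set E :=
  if (i < m)%N then A i else [set z i].

Lemma trajectories_fix A z m N e : (m <= N)%N ->
  trajectories (free_then_fixed A z m.+1) N `&` [set w | Z m w = e] =
  if e \in A m
  then trajectories (free_then_fixed A (fun i => if i == m then e else z i) m) N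
  else set0.
Proof.
move=> mN; case: ifPn => [|/negP] Ame.
  apply/seteqP; split=> w.
    move=> [Aw Zw] i iN; move: (Aw i iN); rewrite /free_then_fixed.
    rewrite [(i < m.+1)%N]ltnS [(i <= m)%N]leq_eqVlt.
    by have [->|im] := eqVneq i m; [rewrite ltnn|].
  move=> Aw; split=> [i iN|]; last first.
    by move: (Aw m mN); rewrite /free_then_fixed ltnn eqxx.
  move: (Aw i iN); rewrite /free_then_fixed.
  rewrite [(i < m.+1)%N]ltnS [(i <= m)%N]leq_eqVlt.
  by have [->|im] := eqVneq i m; [rewrite ltnn /= => ->; rewrite inE in Ame|].
apply/seteqP; split=> w // [Aw Zw]; apply: Ame; rewrite inE -Zw.
by move: (Aw m mN); rewrite /free_then_fixed ltnS leqnn.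
Qed.

(** By induction on [m]: splitting both sides according to the state at time [m]
turns the free coordinate [m] into a fixed one. *)
Lemma trajectories_step A z m n : (m <= n)%N ->
  Pr (trajectories (free_then_fixed A z m) n.+1) =
  Pr (trajectories (free_then_fixed A z m) n) * (K (z n) (z n.+1))%:E.
Proof.
elim: m z => [|m IHm] z mn; first by have [_ _ +] := hZ; exact.
have mZ := measurable_eq_state m.
rewrite (measure_state Pr mZ (measurable_trajectories _ n.+1)).
rewrite (measure_state Pr mZ (measurable_trajectories _ n)).
rewrite muleC -esumZl ?lee_fin//; apply: eq_esum => e _.
rewrite !trajectories_fix ?(ltnW mn)// ?(leqW (ltnW mn))//; case: ifPn => _.
  apply: etrans (IHm _ (ltnW mn)) _.
  by rewrite muleC gtn_eqF// gtn_eqF// ltnS ltnW.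
by rewrite measure0 mule0.
Qed.

Lemma measure_step A n z z' :
  Pr (trajectories A n `&` [set w | Z n.+1 w = z'] `&` [set w | Z n w = z]) =
  Pr (trajectories A n `&` [set w | Z n w = z]) * (K z z')%:E.
Proof.
have [Anz|nAnz] := pselect (A n z); last first.
  have A0 : trajectories A n `&` [set w | Z n w = z] = set0.
    by apply/seteqP; split=> w // [/(_ n (leqnn n)) + Zw]; rewrite Zw.
  by rewrite setIAC A0 set0I measure0 mul0e.
(* Only the values of [s] at the present time n and at time n + 1 matter. *)
pose s i := if i == n then z else z'.
have := trajectories_step A s (leqnn n).
rewrite {3 4}/s eqxx gtn_eqF// => stepE.
have -> : trajectories A n `&` [set w | Z n w = z] =
          trajectories (free_then_fixed A s n) n.
  apply/seteqP; split=> w.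
    move=> [Aw Zw] i; rewrite leq_eqVlt /free_then_fixed.
    move=> /predU1P[->|ilt]; first by rewrite ltnn /s eqxx.
    by rewrite ilt; apply: Aw; exact: ltnW.
  move=> Aw; have : Z n w = z.
    by have := Aw n (leqnn n); rewrite /free_then_fixed ltnn /s eqxx.
  move=> Zw; split=> // i; rewrite leq_eqVlt => /predU1P[->|ilt].
    by rewrite Zw.
  by have := Aw i (ltnW ilt); rewrite /free_then_fixed ilt.
rewrite -stepE; congr (Pr _); apply/seteqP; split=> w.
  move=> [[Aw Zw'] Zw] i; rewrite leq_eqVlt /free_then_fixed.
  move=> /predU1P[->|]; first by rewrite ltnNge leqnSn /s gtn_eqF.
  rewrite ltnS leq_eqVlt => /predU1P[->|ilt]; first by rewrite ltnn /s eqxx.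
  by rewrite ilt; apply: Aw; exact: ltnW.
move=> Aw; have Zw : Z n w = z.
  by have := Aw n (leqnSn n); rewrite /free_then_fixed ltnn /s eqxx.
split=> //; split.
  move=> i; rewrite leq_eqVlt => /predU1P[->|ilt]; first by rewrite Zw.
  by have := Aw i (leqW (ltnW ilt)); rewrite /free_then_fixed ilt.
by have := Aw n.+1 (leqnn _); rewrite /free_then_fixed ltnNge leqnSn /s gtn_eqF.
Qed.

(** The Markov property for a past event of product form. *)
Lemma integral_markov A n V : (forall z, 0 <= V z) ->
  \int[Pr]_(w in trajectories A n) avg (K (Z n w)) V =
  \int[Pr]_(w in trajectories A n) V (Z n.+1 w).
Proof.
move=> V0; have mA := measurable_trajectories A n.
rewrite (integral_state Pr (measurable_eq_state n.+1) mA)//.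
rewrite (integral_state Pr (measurable_eq_state n)
  (f := fun z => avg (K z) V) mA); last first.
  by move=> z; exact: avg_ge0.
have PrI z : measurable (trajectories A n `&` [set w | Z n.+1 w = z]).
  by apply: measurableI => //; exact: measurable_eq_state.
under [RHS]eq_esum do
  rewrite (measure_state Pr (measurable_eq_state n) (PrI _)) -esumZl//.
rewrite esum_exchange; last by move=> z' z; rewrite mule_ge0.
apply: eq_esum => z _; rewrite muleC -esumZl//; last first.
  by move=> z'; rewrite mule_ge0 ?lee_fin.
apply: eq_esum => z' _; rewrite muleA [LHS]muleC.
by congr (_ * _); apply: esym; exact: measure_step.
Qed.

End MarkovProperty.

(** * The first change of an observable *)

(** The integral of a nonnegative function is a supremum over the simple
functions below it, hence is monotone whether or not the
functions are measurable; [g] will be the ratio of distances at the stopping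
time, of which only pointwise lower bounds are known. *)
Lemma le_integral_ge0 (R : realType) (disp : measure_display)
    (T : measurableType disp) (mu : {measure set T -> \bar R})
    (f g : T -> \bar R) :
  (forall w, 0 <= f w)%E -> (forall w, f w <= g w)%E ->
  (\int[mu]_w f w <= \int[mu]_w g w)%E.
Proof.
move=> f0 fg; have g0 w : (0 <= g w)%E by exact: le_trans (fg w).
rewrite !ge0_integralTE//; apply: le_ereal_sup => _ [h hf <-].
by exists h => // w; exact: le_trans (fg w).
Qed.

Section FirstChange.
Context {R : realType} {E : countType} (K : E -> E -> R) (gap : E -> nat).
Local Open Scope ereal_scope.

(** [survival n z] is the probability that the gap of the chain started at [z]
keeps its initial value up to time [n], and [jump n z] the expectation of the
new gap on the event that it changes by time [n].  Recursion on the first step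
is the form in which they occur in the contraction argument. *)
Fixpoint survival (n : nat) (z : E) : \bar R :=
  if n is m.+1 then
    avg (K z) (fun z' => if gap z' == gap z then survival m z' else 0)
  else 1.

Fixpoint jump (n : nat) (z : E) : \bar R :=
  if n is m.+1 then
    avg (K z) (fun z' => if gap z' == gap z then jump m z' else (gap z')%:R%:E)
  else 0.

Hypothesis K0 : forall z z', (0 <= K z z')%R.

Lemma survival_ge0 n z : 0 <= survival n z.
Proof.
elim: n z => [|n IHn] z //=; apply: avg_ge0 => // z'.
by case: ifP.
Qed.

Lemma jump_ge0 n z : 0 <= jump n z.
Proof.
elim: n z => [|n IHn] z //=; apply: avg_ge0 => // z'.
by case: ifP => // _; rewrite lee_fin.
Qed.

Context {z0 : E} {disp : measure_display} {T : measurableType disp}.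
Context {Pr : probability T R} {Z : nat -> T -> E}.
Hypothesis hZ : is_markov_chain K z0 Pr Z.

(* The initial state belongs to the constraint because the chain starts at [z0]
only almost surely. *)
Let constant_gap (i : nat) : set E :=
  [set z | gap z = gap z0 /\ (i = 0%N -> z = z0)].

Definition unchanged : nat -> set T := trajectories (Z := Z) constant_gap.

Definition changes_after (n : nat) : set T :=
  unchanged n `&` [set w | gap (Z n.+1 w) <> gap z0].

Lemma measurable_unchanged n : measurable (unchanged n).
Proof. exact: (measurable_trajectories hZ). Qed.

Lemma measurable_changes_after n : measurable (changes_after n).
Proof.
apply: measurableI; first exact: measurable_unchanged.
exact: (measurable_state (measurable_eq_state hZ n.+1)
  [set z | gap z <> gap z0]).
Qed.

Lemma integral_unchanged0 V : (forall z, 0 <= V z) ->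
  \int[Pr]_(w in unchanged 0) V (Z 0%N w) = V z0.
Proof.
move=> V0; have -> : unchanged 0 = [set w | Z 0%N w = z0].
  apply/seteqP; split=> w; first by move=> /(_ 0%N isT) [_ /(_ erefl)].
  by move=> /= Zw i; rewrite leqn0 => /eqP ->; rewrite /constant_gap Zw.
have mz0 := measurable_eq_state hZ 0%N z0.
rewrite (eq_integral (fun=> V z0)); last by move=> w; rewrite inE /= => ->.
rewrite integral_cst// -[RHS]mule1; congr (_ * _).
by have [_ Pz0 _] := hZ; exact: Pz0.
Qed.

(** The first-step recursion of [survival] and [jump], read along the chain. *)
Lemma integral_unchanged_step n V W :
  (forall z, 0 <= V z) -> (forall z, 0 <= W z) ->
  \int[Pr]_(w in unchanged n)
    avg (K (Z n w)) (fun z' => if gap z' == gap (Z n w) then V z' else W z') =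
  \int[Pr]_(w in unchanged n.+1) V (Z n.+1 w) +
  \int[Pr]_(w in changes_after n) W (Z n.+1 w).
Proof.
move=> V0 W0; pose U z' := if gap z' == gap z0 then V z' else W z'.
have U0 z : 0 <= U z by rewrite /U; case: ifP.
rewrite (eq_integral (fun w => avg (K (Z n w)) U)); last first.
  by move=> w; rewrite inE => /(_ n (leqnn n)) [-> _].
rewrite (integral_markov K0 hZ)// -/(unchanged n).
have unchangedE : unchanged n = unchanged n.+1 `|` changes_after n.
  apply/seteqP; split=> w.
    move=> uw; have [Zw|Zw] := eqVneq (gap (Z n.+1 w)) (gap z0).
      left=> i; rewrite leq_eqVlt ltnS => /predU1P[->|/uw//].
      by split.
    by right; split=> //; exact/eqP.
  by move=> [uw i /leqW/uw //|[]].
have mZ : forall m z, measurable [set w | Z m w = z] := measurable_eq_state hZ.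
rewrite unchangedE ge0_integral_setU//; last 4 first.
- exact: measurable_unchanged.
- exact: measurable_changes_after.
- rewrite -unchangedE; apply: (measurable_fun_state (mZ n.+1)).
  exact: measurable_unchanged.
- apply/disj_setPLR => w uw [_]; apply.
  by have [] := uw n.+1 (leqnn _).
congr (_ + _); apply: eq_integral => w; rewrite inE.
  by move=> /(_ n.+1 (leqnn _)) [Zw _]; rewrite /U Zw eqxx.
by move=> [_ /eqP/negbTE Zw]; rewrite /U Zw.
Qed.

Lemma survivalE n : survival n z0 = Pr (unchanged n).
Proof.
rewrite -(integral_unchanged0 (survival_ge0 n)) -[n in RHS]add0n.
elim: n 0%N => [|n IHn] m.
  by rewrite addn0 integral_cst ?mul1e//; exact: measurable_unchanged.
rewrite (integral_unchanged_step m (V := survival n) (W := fun=> 0))//.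
  by rewrite integral0 adde0 IHn addSnnS.
exact: survival_ge0.
Qed.

Lemma jumpE n : jump n z0 =
  \sum_(0 <= i < n) \int[Pr]_(w in changes_after i) (gap (Z i.+1 w))%:R%:E.
Proof.
rewrite -(integral_unchanged0 (jump_ge0 n)) -[n in RHS]add0n.
elim: n 0%N => [|n IHn] m.
  by rewrite addn0 big_geq// integral0_eq.
rewrite (integral_unchanged_step m (V := jump n)
  (W := fun z => (gap z)%:R%:E)); last 2 first.
- exact: jump_ge0.
- by move=> z; rewrite lee_fin.
by rewrite IHn addnS -addSn [RHS]big_ltn 1?addeC// addSn ltnS leq_addr.
Qed.

Lemma changes_after_inj i j w :
  changes_after i w -> changes_after j w -> i = j.
Proof.
wlog ij : i j / (i <= j)%N.
  move=> wl; have [ij|/ltnW ji] := leqP i j; first exact: wl.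
  by move=> ci cj; apply: esym; exact: wl.
move=> [_ ci] [uj _]; apply/eqP; move: ij; rewrite leq_eqVlt => /orP[//|ij].
by case: ci; have [] := uj i.+1 ij.
Qed.

(** The gap changes for the first time at most once, so the events
[changes_after i] are disjoint and the integrals add up below that of [g]. *)
Lemma sum_integral_changes_le n (W : E -> \bar R) (g : T -> \bar R) :
  (forall z, 0 <= W z) -> (forall w, 0 <= g w) ->
  (forall i w, changes_after i w -> W (Z i.+1 w) <= g w) ->
  \sum_(0 <= i < n) \int[Pr]_(w in changes_after i) W (Z i.+1 w) <=
  \int[Pr]_w g w.
Proof.
move=> W0 g0 Wg.
pose f i := (fun w => W (Z i.+1 w)) \_ (changes_after i).
have f0 i w : 0 <= f i w by rewrite /f patchE; case: ifP.
have mf i : measurable_fun setT (f i).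
  apply/(measurable_restrictT _ (measurable_changes_after i)).1.
  apply: (measurable_fun_state (measurable_eq_state hZ i.+1)).
  exact: measurable_changes_after.
under eq_bigr do rewrite integral_mkcond.
rewrite -ge0_integral_sum//; last by move=> i w _; exact: f0.
apply: le_integral_ge0 => w.
  by apply: sume_ge0 => i _; exact: f0.
have [[i ci]|nc] := pselect (exists i, changes_after i w); last first.
  rewrite big1// => i _; rewrite /f patchE ifN//.
  by apply/negP; rewrite inE => ci; apply: nc; exists i.
have fj j : j != i -> f j w = 0.
  move=> /eqP ji; rewrite /f patchE ifN//; apply/negP; rewrite inE => cj.
  exact/ji/(changes_after_inj cj ci).
have [i_n|n_i] := boolP (i \in index_iota 0 n); last first.
  rewrite big_seq big1// => j jn; apply: fj.
  by apply: contraNneq n_i => <-.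
rewrite (bigD1_seq i)//= ?iota_uniq// big1 ?adde0//.
by rewrite /f patchE; case: ifP => // _; exact: Wg.
Qed.

End FirstChange.

(** * Stopping times of the coupled pair *)

Section ChangeTime.
Context {E : countType} (d : E -> E -> nat) {T : Type} (X Y : nat -> T -> E).
Variables (t : nat) (w : T).

Lemma time_leP n : time_le (change_time d X Y t w) n <->
  exists2 m, (t < m <= n)%N & d (X m w) (Y m w) <> d (X t w) (Y t w).
Proof.
rewrite /change_time; case: pselect => [ex|nex] /=; last first.
  split=> // -[m /andP[tm _] /eqP dm]; case: nex.
  by exists m; rewrite tm.
case: ex_minnP => m /andP[tm /eqP dm] mmin.
split=> [mn|[m' /andP[tm' m'n] /eqP dm']].
  by exists m => //; rewrite tm.
by apply: leq_trans m'n; apply: mmin; rewrite tm'.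
Qed.

Lemma change_timeE n : (t < n)%N -> d (X n w) (Y n w) <> d (X t w) (Y t w) ->
  (forall m, (t < m < n)%N -> d (X m w) (Y m w) = d (X t w) (Y t w)) ->
  change_time d X Y t w = Some n.
Proof.
move=> tn dn dm; rewrite /change_time; case: pselect => [ex|nex]; last first.
  by case: nex; exists n; rewrite tn; exact/eqP.
congr Some; case: ex_minnP => m /andP[tm /eqP dm'] mmin; apply/eqP.
rewrite eqn_leq mmin ?andbT//; last by rewrite tn; exact/eqP.
by rewrite leqNgt; apply/negP => mn; apply: dm'; rewrite dm// tm.
Qed.

End ChangeTime.

Definition gap (Omega : countType) (d : Omega -> Omega -> nat)
    (z : Omega * Omega) : nat := d z.1 z.2.

Section PairChain.
Context {R : realType} {Omega : countType} {d : Omega -> Omega -> nat}.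
Context {S : set (Omega * Omega)} {Q : Omega * Omega -> Omega * Omega -> R}.
Hypothesis Q0 : forall z z', 0 <= Q z z'.
Context {z0 : Omega * Omega} {disp : measure_display} {T : measurableType disp}.
Context {Pr : probability T R} {X Y : nat -> T -> Omega}.
Hypothesis hXY : is_markov_chain Q z0 Pr (fun t w => (X t w, Y t w)).
Local Open Scope ereal_scope.

Local Notation gap := (gap d).

Let Z t w := (X t w, Y t w).

Let unchanged := unchanged gap (z0 := z0) (Z := Z).
Let changes_after := changes_after gap (z0 := z0) (Z := Z).

(** A transition of positive probability is seen on an event of positive
probability, on which the almost sure property of the process applies. *)
Lemma transition_stays z : S z0 -> stays_until_change S d Pr X Y ->
  Q z0 z != 0%R -> gap z = gap z0 -> S z.
Proof.
move=> Sz0 stay Qz gz; pose B := [set w | Z 0%N w = z0 /\ Z 1%N w = z].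
have mB : measurable B.
  by apply: measurableI; exact: (measurable_eq_state hXY).
have [Sz|nSz] := pselect (S z); first by [].
have B_bad : B `<=` ~` [set w | forall t t', S (X t w, Y t w) -> (t < t')%N ->
     ~~ time_le (change_time d X Y t w) t' -> S (X t' w, Y t' w)].
  move=> w [Z0w Z1w] /(_ 0%N 1%N); rewrite -/(Z 0%N w) -/(Z 1%N w) Z0w Z1w.
  move=> /(_ Sz0 isT) H; apply/nSz/H; apply/negP => /time_leP[m].
  case: m => [//|[|//]] _; apply.
  by rewrite -/(gap (Z 1%N w)) -/(gap (Z 0%N w)) Z0w Z1w.
have PrB : Pr B = 0.
  by apply/(negligibleP _ mB); exact: negligibleS B_bad stay.
have [_ Pz0 step] := hXY.
have := step 0%N (fun i => if i is 0%N then z0 else z).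
rewrite (_ : [set w | _] = B); last first.
  apply/seteqP; split=> w.
    by move=> Zw; split; [exact: (Zw 0%N)|exact: (Zw 1%N)].
  by move=> [Z0w Z1w] [|[|//]] _.
rewrite (_ : [set w | _] = [set w | Z 0%N w = z0]); last first.
  apply/seteqP; split=> w; first by move=> Zw; exact: (Zw 0%N).
  by move=> Z0w [|//] _.
rewrite PrB Pz0 mul1e => -[] /esym/eqP; rewrite (negbTE Qz)//.
Qed.

Lemma survival_le (p : R) k :
  p%:E <= Pr [set w | time_le (change_time d X Y 0 w) k] ->
  survival Q gap k z0 <= (1 - p)%:E.
Proof.
move=> pT; rewrite (survivalE gap Q0 hXY) -/(unchanged k).
have mZ := measurable_eq_state hXY.
have mU : measurable (unchanged k) by exact: (measurable_unchanged gap hXY).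
have mT : measurable [set w | time_le (change_time d X Y 0 w) k].
  rewrite (_ : [set w | _] = \bigcup_(m in [set m | (0 < m <= k)%N]) \bigcup_v
     ([set w | gap (Z m w) <> v] `&` [set w | gap (Z 0%N w) = v])).
    apply: bigcup_measurable => m _; apply: bigcup_measurable => v _.
    apply: measurableI.
      exact: (measurable_state (mZ m) [set z | gap z <> v]).
    exact: (measurable_state (mZ 0%N) [set z | gap z = v]).
  apply/seteqP; split=> w.
    by move=> /time_leP[m mk dm]; exists m => //; exists (gap (Z 0%N w)).
  move=> [m mk [v _ [dm d0]]]; apply/time_leP; exists m => // d_eq.
  by apply: dm; exact: etrans d_eq d0.
have TU : [set w | time_le (change_time d X Y 0 w) k] `<=` ~` unchanged k.
  move=> w /time_leP[m /andP[_ mk] dm] uw; apply: dm.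
  have [gm _] := uw m mk; have [g0 _] := uw 0%N isT.
  exact: etrans gm (esym g0).
have : p%:E <= 1 - Pr (unchanged k).
  rewrite -probability_setC//; apply: le_trans pT _.
  by apply: le_measure; rewrite ?inE//; exact: measurableC.
have /fineK <- : Pr (unchanged k) \is a fin_num by exact: fin_num_measure.
by rewrite -EFinB !lee_fin; lra.
Qed.

Lemma jump_le (alpha : R) n : (0 <= alpha)%R -> (0 < gap z0)%N ->
  'E_Pr[change_ratio R d X Y] <= alpha%:E ->
  jump Q gap n z0 <= (alpha * (gap z0)%:R)%:E.
Proof.
move=> a0 g0 Ea; rewrite (jumpE gap Q0 hXY).
have gR0 : (0 < (gap z0)%:R :> R)%R by rewrite ltr0n.
have mZ := measurable_eq_state hXY.
rewrite -(@eq_bigr _ _ _ _ _ _ (fun i => (gap z0)%:R%:E *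
  \int[Pr]_(w in changes_after i)
    ((gap (Z i.+1 w))%:R / (gap z0)%:R)%:E)); last first.
  move=> i _; have mC := measurable_changes_after gap hXY i.
  have mW := measurable_fun_state (mZ i.+1)
    (fun z => ((gap z)%:R / (gap z0)%:R)%:E) mC.
  rewrite -ge0_integralZl_EFin//.
  by apply: eq_integral => w _; rewrite -EFinM mulrC divfK// gt_eqF.
rewrite -ge0_sume_distrr; last first.
  by move=> i _; apply: integral_ge0 => w _; rewrite lee_fin divr_ge0.
rewrite mulrC EFinM lee_wpmul2l ?lee_fin//; apply: le_trans Ea.
rewrite expectation.unlock.
apply: (sum_integral_changes_le hXY n
  (W := fun z => ((gap z)%:R / (gap z0)%:R)%:E)).
- by move=> z; rewrite lee_fin divr_ge0.
- move=> w; rewrite lee_fin /change_ratio.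
  by case: change_time => // m; rewrite divr_ge0.
move=> i w [uw gw]; have [_ /(_ erefl) Z0w] := uw 0%N isT.
rewrite /change_ratio (@change_timeE _ _ _ _ _ _ _ i.+1)//.
- by rewrite -Z0w.
- by move: gw; rewrite -Z0w.
- by move=> m /andP[_ mi]; have [+ _] := uw m mi; rewrite -Z0w.
Qed.

End PairChain.

(** * Contraction on adjacent pairs *)

Section MarkovOperator.
Context {R : realType} {Omega : countType}.
Local Open Scope ereal_scope.

Definition markov_op (P : Omega -> Omega -> R) (h : Omega -> \bar R) x :=
  avg (P x) h.

Variable P : Omega -> Omega -> R.
Hypothesis hP : is_kernel P.

Lemma iter_markov_op_ge0 h t x : (forall x, 0 <= h x) ->
  0 <= iter t (markov_op P) h x.
Proof.
move=> h0; elim: t x => [|t IHt] x //=; apply: avg_ge0 => //.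
by have [] := hP x.
Qed.

Lemma iter_markov_op_le1 h t x : (forall x, h x <= 1) ->
  iter t (markov_op P) h x <= 1.
Proof. by move=> h1; elim: t x => [|t IHt] x //=; exact: le_avg_cst. Qed.

Lemma iter_markov_op_cst (c : R) t x : (0 <= c)%R ->
  iter t (markov_op P) (fun=> c%:E) x = c%:E.
Proof.
move=> c0; elim: t x => [|t IHt] x //=; rewrite -[RHS](avg_cst (hP x) c0).
by apply: eq_esum => y _; rewrite IHt.
Qed.

(** One-sided, because [S] consists of ordered pairs, and additive, so that no
difference of infinite quantities arises. *)
Lemma coupling_step q x y h V : is_coupling q (P x) (P y) ->
  (forall x, 0 <= h x) -> (forall z, 0 <= V z) ->
  (forall z, q z != 0%R -> h z.1 <= h z.2 + V z) ->
  markov_op P h x <= markov_op P h y + avg q V.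
Proof.
move=> cq h0 V0 hV; have [[q0 _] _ _] := cq.
have [hx hy] := avg_coupling cq h0; rewrite /markov_op -hx -hy -avgD//.
exact: le_avg.
Qed.

End MarkovOperator.

(** A shortest path has length [d x y], so the bounds of its edges add up to
exactly [C * d x y]. *)
Lemma lipschitz_along_paths (R : realType) (Omega : countType)
    (d : Omega -> Omega -> nat) (S : set (Omega * Omega)) (C : R)
    (h : Omega -> \bar R) : is_path_metric S d -> 0 <= C ->
  (forall z, S z -> (h z.1 <= h z.2 + (C * (gap d z)%:R)%:E)%E) ->
  forall x y, (h x <= h y + (C * (d x y)%:R)%:E)%E.
Proof.
move=> dS C0 hS x y; have [[s [s_path <-] <-] _] := dS x y.
elim: s x s_path => [|u s IHs] x /=; first by rewrite mulr0 adde0.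
move=> /andP[]; rewrite inE => xu /IHs hu.
apply: (le_trans (hS _ xu)); rewrite natrD mulrDr EFinD addeA addeAC.
by rewrite leeD2r.
Qed.

Section Contraction.
Context {R : realType} {Omega : countType} {P : Omega -> Omega -> R}.
Context {d : Omega -> Omega -> nat} {S : set (Omega * Omega)}.
Context {Q : Omega * Omega -> Omega * Omega -> R}.
Hypothesis hP : is_kernel P.
Hypothesis hd : is_metric d.
Hypothesis hdS : is_path_metric S d.
Hypothesis cQ : forall x y, is_coupling (Q (x, y)) (P x) (P y).
Hypothesis Sclosed : forall z z', S z -> Q z z' != 0 ->
  gap d z' = gap d z -> S z'.
Local Open Scope ereal_scope.

Local Notation gap := (gap d).
Local Notation survival := (survival Q gap).
Local Notation jump := (jump Q gap).
Local Notation run := (fun t => iter t (markov_op P)).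

Lemma coupling_ge0 z z' : (0 <= Q z z')%R.
Proof. by case: z => x y; have [[+ _] _ _] := cQ x y; apply. Qed.

Let survival0 n z := survival_ge0 gap coupling_ge0 n z.
Let jump0 n z := jump_ge0 gap coupling_ge0 n z.

(** Strong form of the induction on time.  A pair that keeps its gap stays in
[S], where the bound at time [t] applies; a pair that changes its gap may leave
[S] and is charged [C] times its new distance.  The assumption on all pairs may
use the bound on [S] at the same time, from which it will be derived by
adding along paths.  The charge [gamma] for a gap that is still unchanged is 1
for an arbitrary function with values in [0, 1], and [(1 - alpha) * gap] for a
function already controlled by the weight. *)
Lemma propagate (h : Omega -> \bar R) (C : R) (gamma : nat -> R) (m : nat) :
  (forall x, 0 <= h x) -> (0 <= C)%R -> (forall i, 0 <= gamma i)%R ->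
  let bound t z :=
    C%:E * ((gamma (gap z))%:E * survival t z + jump (t + m) z) in
  (forall z, S z -> h z.1 <= h z.2 + bound 0%N z) ->
  (forall t, (forall z, S z -> run t h z.1 <= run t h z.2 + bound t z) ->
     forall x y, run t h x <= run t h y + (C * (d x y)%:R)%:E) ->
  forall t z, S z -> run t h z.1 <= run t h z.2 + bound t z.
Proof.
move=> h0 C0 gamma0 bound start lip; elim=> [|t IHt] z Sz; first exact: start.
pose same z' := gap z' == gap z.
pose alive z' := if same z' then survival t z' else 0.
pose moved z' := if same z' then jump (t + m) z' else (gap z')%:R%:E.
have alive0 z' : 0 <= alive z' by rewrite /alive; case: ifP.
have moved0 z' : 0 <= moved z'.
  by rewrite /moved; case: ifP => // _; rewrite lee_fin.
pose V z' := C%:E * ((gamma (gap z))%:E * alive z' + moved z').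
have ga0 z' : 0 <= (gamma (gap z))%:E * alive z' by rewrite mule_ge0 ?lee_fin.
have -> : bound t.+1 z = avg (Q z) V.
  rewrite avgZ ?lee_fin// ?avgD ?avgZ ?lee_fin// => *; rewrite ?adde_ge0//;
    exact: coupling_ge0.
have cQz : is_coupling (Q z) (P z.1) (P z.2) by case: (z) => x y; exact: cQ.
apply: (coupling_step cQz) => [x'|z'|z' Qz'].
- exact: iter_markov_op_ge0.
- by rewrite mule_ge0 ?lee_fin// adde_ge0.
rewrite /V /alive /moved; case: ifPn => [/eqP gz|_].
  by rewrite -gz; apply: IHt; exact: Sclosed gz.
by rewrite mule0 add0e; exact: lip.
Qed.

Lemma survival_le1 n z : survival n z <= 1.
Proof.
elim: n z => [|n IHn] [x y] //=; apply: le_avg_cst => //.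
  by have [] := cQ x y.
by move=> z; case: ifP => _ //; rewrite lee_fin.
Qed.

(** The Markov property at time [n] for the survival probability. *)
Lemma survivalD (c : R) m n : (0 <= c)%R ->
  (forall z, S z -> survival m z <= c%:E) ->
  forall z, S z -> survival (n + m) z <= c%:E * survival n z.
Proof.
move=> c0 cm; elim: n => [|n IHn] z Sz; first by rewrite mule1; exact: cm.
rewrite addSn /= -avgZ ?lee_fin//; last 2 first.
- exact: coupling_ge0.
- by move=> z'; case: ifP.
apply: le_avg => [|z' Qz']; first exact: coupling_ge0.
case: ifPn => [/eqP gz|_]; last by rewrite mule0.
by apply: IHn; exact: Sclosed gz.
Qed.

Section Rates.
Hypothesis S_neq : forall x y, S (x, y) -> x <> y.
Context {p alpha : R} {k : nat}.
Hypothesis p0 : (0 <= p)%R.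
Hypothesis p1 : (p <= 1)%R.
Hypothesis alpha0 : (0 <= alpha)%R.
Hypothesis alpha1 : (alpha < 1)%R.
Hypothesis hsurv : forall z, S z -> survival k z <= (1 - p)%:E.
Hypothesis hjump : forall n z, S z -> jump n z <= (alpha * (gap z)%:R)%:E.

Let beta := (1 - alpha)%R.
Let rho := (1 - p * beta)%R.

Let beta0 : (0 <= beta)%R. Proof. by rewrite subr_ge0 ltW. Qed.

Lemma gap_gt0 z : S z -> (0 < gap z)%N.
Proof.
case: z => x y /S_neq xy; rewrite lt0n; apply/eqP => d0; apply: xy.
by have [dP _ _] := hd; apply/dP.
Qed.

Lemma survival_geometric j z : S z -> survival (j * k)%N z <= ((1 - p) ^+ j)%:E.
Proof.
elim: j z => [|j IHj] z Sz //.
rewrite mulSn exprSr EFinM.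
apply: (le_trans (survivalD k _ IHj Sz)); first by rewrite exprn_ge0// subr_ge0.
by rewrite lee_wpmul2l ?lee_fin ?exprn_ge0 ?subr_ge0// hsurv.
Qed.

Lemma weight_le_gap n z (s : \bar R) : S z -> s <= (beta * (gap z)%:R)%:E ->
  s + jump n z <= (gap z)%:R%:E.
Proof.
move=> Sz sb; apply: le_trans (leeD sb (hjump n Sz)) _.
by rewrite -EFinD -mulrDl /beta subrK mul1r.
Qed.

(** A pair whose gap has changed costs at most its new distance, which is a
positive integer when its states differ, so that the values of [g] do not
matter; a pair whose gap has not changed costs at most 1.  After [j] blocks the
probability of the latter is at most [1 - alpha]. *)
Lemma burn_in j (g : Omega -> \bar R) z :
  ((1 - p) ^+ j <= beta)%R ->
  (forall x, 0 <= g x) -> (forall x, g x <= 1) -> S z ->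
  run (j * k)%N g z.1 <=
  run (j * k)%N g z.2 + ((beta * (gap z)%:R)%:E + jump (j * k)%N z).
Proof.
move=> jbeta g0 g1 Sz.
have := @propagate g 1%R (fun=> 1%R) 0%N g0 ler01 (fun=> ler01).
move=> /= /(_ _ _ (j * k)%N z Sz).
rewrite addn0 !mul1e => prop; apply: le_trans (prop _ _) _.
- by move=> z' _; rewrite ?mul1e ?adde0 (le_trans (g1 _))// leeDr.
- move=> t _ x y; have [->|xy] := eqVneq x y.
    by rewrite leeDl// lee_fin mulr_ge0.
  apply: (le_trans (iter_markov_op_le1 hP t x g1)).
  apply: (@le_trans _ _ (1 * (d x y)%:R)%:E); last first.
    by rewrite leeDr// iter_markov_op_ge0.
  rewrite mul1r lee_fin ler1n lt0n; apply: contra_neq xy.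
  by have [dP _ _] := hd => /dP.
apply: leeD2l; apply: leeD2r; apply: le_trans (survival_geometric j Sz) _.
by rewrite lee_fin (le_trans jbeta)// ler_peMr// ler1n gap_gt0.
Qed.

(** In [k] steps the probability that the gap is unchanged drops from 1 to at
most [1 - p].  This removes [p * (1 - alpha) * gap] from the weight, which is at
least the fraction [p * (1 - alpha)] of it because the weight is at most the
gap. *)
Lemma contraction_block (h : Omega -> \bar R) (C : R) m :
  (forall x, 0 <= h x) -> (0 <= C)%R ->
  (forall z, S z ->
     h z.1 <= h z.2 + C%:E * ((beta * (gap z)%:R)%:E + jump m z)) ->
  forall z, S z -> run k h z.1 <=
    run k h z.2 + (C * rho)%:E * ((beta * (gap z)%:R)%:E + jump (k + m)%N z).
Proof.
move=> h0 C0 start z Sz; have CE0 : 0 <= C%:E by rewrite lee_fin.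
have := @propagate h C (fun i => beta * i%:R)%R m h0 C0.
move=> /= /(_ _ _ _ k z Sz) prop; apply: le_trans (prop _ _ _) _.
- by move=> i; rewrite mulr_ge0.
- by move=> z' Sz'; rewrite add0n mule1; exact: start.
- move=> t tbound; apply: lipschitz_along_paths hdS C0 _ => z' Sz'.
  apply: (le_trans (tbound z' Sz')).
  rewrite leeD2l// [in leRHS]EFinM lee_wpmul2l//.
  apply: (weight_le_gap _ Sz').
  by rewrite -[leRHS]mule1 lee_wpmul2l ?lee_fin ?mulr_ge0// survival_le1.
rewrite [(C * rho)%:E]EFinM -muleA leeD2l// lee_wpmul2l//.
have jn := hjump (k + m)%N Sz; have jf : jump (k + m)%N z \is a fin_num.
  by rewrite ge0_fin_numE// (le_lt_trans jn)// ltry.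
move: jn; rewrite -(fineK jf); set b := fine _; rewrite lee_fin => jn.
have b0 : (0 <= b)%R by rewrite -lee_fin /b fineK.
apply: (@le_trans _ _ ((beta * (gap z)%:R)%:E * (1 - p)%:E + b%:E)).
  by rewrite leeD2r// lee_wpmul2l ?lee_fin ?mulr_ge0// hsurv.
rewrite -EFinM -!EFinD -EFinM lee_fin /rho.
have := mulr_ge0 p0 beta0; rewrite /beta in jn *; nra.
Qed.

Lemma oscillation_decay j n (g : Omega -> \bar R) :
  ((1 - p) ^+ j <= beta)%R ->
  (forall x, 0 <= g x) -> (forall x, g x <= 1) ->
  forall x y, run ((n + j) * k)%N g x <=
    run ((n + j) * k)%N g y + (rho ^+ n * (d x y)%:R)%:E.
Proof.
move=> jbeta g0 g1.
have rho0 : (0 <= rho)%R.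
  by rewrite subr_ge0 mulr_ile1// /beta lerBlDr lerDl.
have block z : S z ->
    run ((n + j) * k)%N g z.1 <= run ((n + j) * k)%N g z.2 +
    (rho ^+ n)%:E * ((beta * (gap z)%:R)%:E + jump ((n + j) * k)%N z).
  elim: n z => [|n IHn] z Sz; first by rewrite mul1e; exact: burn_in.
  rewrite addSn mulSn !iterD exprSr.
  apply: contraction_block => //; last exact: exprn_ge0.
  by move=> x; exact: iter_markov_op_ge0.
apply: lipschitz_along_paths hdS (exprn_ge0 _ rho0) _ => z Sz.
apply: (le_trans (block z Sz)).
rewrite leeD2l// [in leRHS]EFinM lee_wpmul2l ?lee_fin ?exprn_ge0//.
exact: weight_le_gap.
Qed.

End Rates.
End Contraction.

(** * Total variation and oscillation *)

Section LawsAndTotalVariation.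
Context {R : realType} {Omega : countType}.
Local Open Scope ereal_scope.

Lemma avg_pointmass (x : Omega) (g : Omega -> \bar R) : 0 <= g x ->
  avg (fun y => (x == y)%:R) g = g x.
Proof.
move=> gx; rewrite -[RHS](esum_set1 gx) [RHS]esum_mkcond.
apply: eq_esum => y _; have [->|xy] := eqVneq x y.
  by rewrite mul1e mem_set.
rewrite mul0e ifN//; apply/negP; rewrite inE => yx.
by rewrite yx eqxx in xy.
Qed.

Lemma avg_next (mu nu : Omega -> R) (P : Omega -> Omega -> R)
    (g : Omega -> \bar R) :
  (forall x, 0 <= mu x)%R -> is_kernel P -> (forall x, 0 <= g x) ->
  (forall y, avg mu (fun z => (P z y)%:E) = (nu y)%:E) ->
  avg nu g = avg mu (markov_op P g).
Proof.
move=> mu0 hP g0 nuE.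
have P0 x y : (0 <= P x y)%R by have [] := hP x.
transitivity (\esum_(y in [set: Omega]) \esum_(z in [set: Omega])
    ((mu z)%:E * ((P z y)%:E * g y))).
  apply: eq_esum => y _; rewrite -nuE muleC /avg -esumZl//.
    by apply: eq_esum => z _; rewrite muleC muleA.
  by move=> z; rewrite mule_ge0 ?lee_fin.
rewrite esum_exchange; last by move=> y z; rewrite !mule_ge0 ?lee_fin.
apply: eq_esum => z _; rewrite esumZl ?lee_fin// => y.
by rewrite mule_ge0 ?lee_fin.
Qed.

Lemma avg_law_at (P : Omega -> Omega -> R) x t : is_kernel P ->
  (forall y, 0 <= law_at P x t y)%R /\
  forall g, (forall y, 0 <= g y) ->
    avg (law_at P x t) g = iter t (markov_op P) g x.
Proof.
move=> hP; elim: t => [|t [law0 IHt]].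
  by split=> [y|g g0]; [exact: ler0n|exact: avg_pointmass].
have P0 z y : (0 <= P z y)%R by have [] := hP z.
have P1 z y : (P z y)%:E <= 1.
  have [_ <-] := hP z; apply: esum_ge.
  exists [set y]; last by rewrite fsbig_set1.
  by split; [exact: finite_set1|].
have lawE y : avg (law_at P x t) (fun z => (P z y)%:E) = (law_at P x t.+1 y)%:E.
  have -> : law_at P x t.+1 y = fine (avg (law_at P x t) (fun z => (P z y)%:E)).
    by congr fine; apply: eq_esum => z _; rewrite EFinM.
  rewrite fineK// ge0_fin_numE; last first.
    by apply: avg_ge0 => // z; rewrite lee_fin.
  rewrite IHt; last by move=> z; rewrite lee_fin.
  apply: le_lt_trans (ltry 1).
  exact: iter_markov_op_le1.
have lawS0 y : (0 <= law_at P x t.+1 y)%R.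
  by rewrite -lee_fin -lawE avg_ge0// => z; rewrite lee_fin.
split=> // g g0; rewrite (avg_next law0 hP g0 lawE) IHt ?iterSr// => z.
by apply: avg_ge0.
Qed.

Lemma avg_equilibrium (P : Omega -> Omega -> R) pi t g :
  is_kernel P -> is_equilibrium P pi ->
  (forall x, 0 <= g x) -> avg pi (iter t (markov_op P) g) = avg pi g.
Proof.
move=> hP [[pi0 _] piP] g0; elim: t => [//|t IHt].
rewrite -IHt; symmetry; apply: (avg_next pi0 hP) => [x|y].
  exact: iter_markov_op_ge0.
by rewrite -piP; apply: eq_esum => x _; rewrite EFinM.
Qed.

(** Tested against the indicator of the states to which [mu] gives more mass. *)
Lemma esum_excess_le (mu nu : Omega -> R) (eps : R) :
  (forall x, 0 <= mu x)%R -> is_distr nu ->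
  (forall g, (forall x, 0 <= g x) -> (forall x, g x <= 1) ->
     avg mu g <= avg nu g + eps%:E) ->
  \esum_(x in [set: Omega]) (Num.max (mu x - nu x) 0)%:E <= eps%:E.
Proof.
move=> mu0 dnu; have [nu0 _] := dnu.
pose g x : \bar R := ((nu x < mu x)%R)%:R%:E.
have g0 x : 0 <= g x by rewrite lee_fin.
have g1 x : g x <= 1 by rewrite /g lee_fin lern1 leq_b1.
move=> /(_ g g0 g1).
have -> : avg mu g =
    \esum_(x in [set: Omega]) (Num.max (mu x - nu x) 0)%:E + avg nu g.
  rewrite -esumD; last 2 first.
  - by move=> x _; rewrite lee_fin le_max lexx orbT.
  - by move=> x _; rewrite mule_ge0 ?lee_fin.
  apply: eq_esum => x _; rewrite /g; case: ltP => numu.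
    by rewrite !mule1 -EFinD max_l ?subr_ge0 1?ltW// subrK.
  by rewrite !mule0 adde0 max_r// subr_le0.
rewrite addeC leeD2lE// ge0_fin_numE ?avg_ge0//.
by apply: le_lt_trans (ltry 1); exact: le_avg_cst.
Qed.

Lemma tv_dist_le (mu nu : Omega -> R) (eps : R) : is_distr mu -> is_distr nu ->
  (forall g, (forall x, 0 <= g x) -> (forall x, g x <= 1) ->
     avg mu g <= avg nu g + eps%:E /\ avg nu g <= avg mu g + eps%:E) ->
  tv_dist mu nu <= eps%:E.
Proof.
move=> dmu dnu close; have [mu0 _] := dmu; have [nu0 _] := dnu.
have max0 (r : R) : 0 <= (Num.max r 0)%:E by rewrite lee_fin le_max lexx orbT.
rewrite /tv_dist (_ : esum _ _ =
    \esum_(x in [set: Omega]) (Num.max (mu x - nu x) 0)%:E +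
    \esum_(x in [set: Omega]) (Num.max (nu x - mu x) 0)%:E); last first.
  rewrite -esumD//; apply: eq_esum => x _; rewrite -EFinD; congr EFin.
  by case: (lerP 0 (mu x - nu x)) => h; [rewrite ger0_norm// max_r|
    rewrite ltr0_norm// max_l]; lra.
have -> : eps%:E = (2^-1)%:E * (eps%:E + eps%:E).
  by rewrite -EFinD -EFinM; congr EFin; lra.
apply: lee_wpmul2l; first by rewrite lee_fin.
by apply: leeD; apply: esum_excess_le => // g g0 g1; have [] := close g g0 g1.
Qed.

(** Later times follow from time [t] because averaging keeps values in [0, 1];
the average of [P^t g] over equilibrium is that of [g], and it is within [eps]
of each value of [P^t g]. *)
Lemma mixed_of_oscillation (P : Omega -> Omega -> R) pi (eps : R) t :
  is_kernel P -> is_equilibrium P pi ->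
  (forall g, (forall x, 0 <= g x) -> (forall x, g x <= 1) ->
     forall x y,
     iter t (markov_op P) g x <= iter t (markov_op P) g y + eps%:E) ->
  mixed_from P pi eps t.
Proof.
move=> hP hpi osc t' tt' x.
have {}osc g : (forall x, 0 <= g x) -> (forall x, g x <= 1) -> forall x y,
    iter t' (markov_op P) g x <= iter t' (markov_op P) g y + eps%:E.
  move=> g0 g1; rewrite -(subnKC tt') iterD; apply: osc => y.
    exact: iter_markov_op_ge0.
  exact: iter_markov_op_le1.
have eps0 : (0 <= eps)%R.
  have := osc (fun=> 0) (fun=> lexx _) (fun=> lee01) x x.
  by rewrite (iter_markov_op_cst hP t' x (lexx 0%R)) add0e lee_fin.
have [law0 lawE] := avg_law_at x t' hP; have [dpi _] := hpi.
have [pi0 _] := dpi.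
have dlaw : is_distr (law_at P x t').
  split=> //; rewrite -[LHS](eq_esum (fun y _ => mule1 _)) [LHS]lawE//.
  exact: iter_markov_op_cst.
apply: tv_dist_le => // g g0 g1; rewrite lawE// -(avg_equilibrium t' hP hpi g0).
have it0 y : 0 <= iter t' (markov_op P) g y by exact: iter_markov_op_ge0.
have it1 y : iter t' (markov_op P) g y <= 1 by exact: iter_markov_op_le1.
have fx : iter t' (markov_op P) g x \is a fin_num.
  by rewrite ge0_fin_numE// (le_lt_trans (it1 x))// ltry.
split.
  rewrite -(fineK fx) -(avg_cst dpi (fine_ge0 (it0 x))).
  rewrite -(avg_cst dpi eps0) -avgD//.
  by apply: le_avg => // y _; rewrite fineK// osc.
rewrite -(fineK fx) -EFinD; apply: le_avg_cst => // [|y].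
  by rewrite addr_ge0// fine_ge0.
by rewrite EFinD fineK// osc.
Qed.

End LawsAndTotalVariation.

(** * The number of steps *)

Section Durations.
Context {R : realType}.

(** From [1 - q <= exp (- q)], with [n] the integer following [- ln y / q]. *)
Lemma exp_decay_le (q y : R) : 0 < q -> q <= 1 -> 0 < y -> y <= 1 ->
  exists2 n : nat, (1 - q) ^+ n <= y & n%:R <= - ln y / q + 1.
Proof.
move=> q0 q1 y0 y1; pose x := - ln y / q.
have x0 : 0 <= x by rewrite divr_ge0 ?(ltW q0)// oppr_ge0 ln_le0.
have /andP[tx xt] := truncn_itv x0.
exists (Num.truncn x).+1; last by rewrite -natr1 lerD2r.
have step : 1 - q <= expR (- q) := expR_ge1Dx (- q).
apply: (@le_trans _ _ (expR (- q) ^+ (Num.truncn x).+1)).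
  by rewrite lerXn2r ?nnegrE ?subr_ge0 ?expR_ge0.
rewrite -expRM_natr -[leRHS]lnK ?posrE// ler_expR.
move/ltW: xt; rewrite ler_pdivrMr// => xt.
by rewrite mulNr lerNl mulrC.
Qed.

(** With [l = ln (D / eps)], the bound [- ln (1 - alpha) <= alpha / (1 - alpha)]
and the two rounding errors give
[(n + j) * p * (1 - alpha) <= l + alpha + 2 * p * (1 - alpha) <= l + 2 - alpha],
which is at most [(2 - alpha) * (1 + l)], and [1 + l <= ln (2 * e * D / eps)]. *)
Lemma duration_le (k j n D : nat) (p alpha eps : R) :
  0 < p -> p <= 1 -> alpha < 1 -> 0 <= alpha -> 0 < eps -> eps < 1 ->
  (0 < D)%N ->
  j%:R <= - ln (1 - alpha) / p + 1 ->
  n%:R <= - ln (eps / D%:R) / (p * (1 - alpha)) + 1 ->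
  ((n + j) * k)%:R <=
    k%:R * (2 - alpha) / (p * (1 - alpha)) * ln (2 * expR 1 * D%:R / eps).
Proof.
move=> p0 p1 a1 a0 e0 e1 D0 hj hn.
have b0 : 0 < 1 - alpha by rewrite subr_gt0.
have D1 : 1 <= D%:R :> R by rewrite ler1n.
have DR0 : 0 < D%:R :> R by rewrite ltr0n.
pose l := - ln (eps / D%:R).
have l0 : 0 <= l.
  by rewrite oppr_ge0 ln_le0// ler_pdivrMr// mul1r (le_trans (ltW e1)).
have logE : 1 + l <= ln (2 * expR 1 * D%:R / eps).
  have -> : 2 * expR 1 * D%:R / eps = 2 * (expR 1 * (eps / D%:R)^-1).
    by rewrite invf_div !mulrA.
  rewrite !lnM ?posrE ?mulr_gt0 ?invr_gt0 ?divr_gt0 ?expR_gt0//.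
  rewrite expRK lnV ?posrE ?divr_gt0//.
  by rewrite -/l lerDr ln_ge0// ler1n.
have lnb : - ln (1 - alpha) * (1 - alpha) <= alpha.
  have ln_inv : ln (1 + ((1 - alpha)^-1 - 1)) <= (1 - alpha)^-1 - 1.
    by apply: le_ln1Dx; rewrite ltrBrDl addrN invr_gt0.
  rewrite addrC subrK lnV ?posrE// in ln_inv.
  apply: le_trans (ler_wpM2r (ltW b0) ln_inv) _.
  by rewrite mulrBl mulVf ?gt_eqF// mul1r; lra.
have pb0 : 0 < p * (1 - alpha) by rewrite mulr_gt0.
set L := ln (2 * _ * _ / _) in logE *.
rewrite natrM mulrC -!mulrA ler_wpM2l// mulrA mulrAC ler_pdivlMr// natrD.
have hj' : j%:R * (p * (1 - alpha)) <= alpha + p * (1 - alpha).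
  apply: le_trans (ler_wpM2r (ltW pb0) hj) _.
  rewrite mulrDl mul1r lerD2r mulrA divfK ?gt_eqF//.
have hn' : n%:R * (p * (1 - alpha)) <= l + p * (1 - alpha).
  apply: le_trans (ler_wpM2r (ltW pb0) hn) _.
  by rewrite mulrDl mul1r lerD2r divfK ?gt_eqF.
apply: (@le_trans _ _ ((2 - alpha) * (1 + l))); last first.
  by rewrite ler_wpM2l//; lra.
have pb1 : p * (1 - alpha) <= 1 - alpha by rewrite ler_piMl// ltW.
have la : 0 <= (1 - alpha) * l by rewrite mulr_ge0// ltW.
rewrite mulrDl; lra.
Qed.

End Durations.

Theorem theorem2p4 (R : realType) (Omega : countType)
    (P : Omega -> Omega -> R) (hP : is_kernel P)
    (pi : Omega -> R) (hpi : is_equilibrium P pi)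
    (d : Omega -> Omega -> nat) (hd : is_metric d)
    (D : nat) (hD : is_diameter d D)
    (S : set (Omega * Omega)) (hS : forall x y, S (x, y) -> x <> y)
    (hdS : is_path_metric S d)
    (Q : Omega * Omega -> Omega * Omega -> R) (hQ : is_path_coupling P S Q)
    (disp : measure_display) (T : measurableType disp)
    (Pr : Omega * Omega -> probability T R) (X Y : nat -> T -> Omega)
    (hXY : forall z0,
       is_markov_chain Q z0 (Pr z0) (fun t w => (X t w, Y t w)))
    (hstay : forall z0, stays_until_change S d (Pr z0) X Y)
    (k : nat) (hk : (0 < k)%N) (p : R) (hp : 0 < p)
    (alpha : R) (halpha0 : 0 < alpha) (halpha1 : alpha < 1)
    (hi : forall z0, S z0 ->
       (p%:E <= Pr z0 [set w | time_le (change_time d X Y 0 w) k])%E)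
    (hii : forall z0, S z0 ->
       ('E_(Pr z0)[change_ratio R d X Y] <= alpha%:E)%E)
    (eps : R) (heps0 : 0 < eps) (heps1 : eps < 1) :
  exists2 tau : nat, is_mixing_time P pi eps tau &
    tau%:R <= k%:R * (2 - alpha) / (p * (1 - alpha))
              * ln (2 * expR 1 * D%:R / eps).
Proof.
suff [t mixed_t t_le] : exists2 t : nat, mixed_from P pi eps t &
    t%:R <= k%:R * (2 - alpha) / (p * (1 - alpha))
            * ln (2 * expR 1 * D%:R / eps).
  have ex_mixed : exists t, `[< mixed_from P pi eps t >].
    by exists t; apply/asboolP.
  have [tau /asboolP mixed_tau tau_min] := ex_minnP ex_mixed.
  exists tau; first by split=> // s /asboolP; exact: tau_min.
  by apply: le_trans t_le; rewrite ler_nat; apply: tau_min; apply/asboolP.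
have [d_le [x1 [y1 d_max]]] := hD.
have [D0|D_gt0] := posnP D.
  exists 0%N; last by rewrite D0 mulr0 mul0r ln0// mulr0.
  apply: mixed_of_oscillation => // g _ _ x y.
  have -> : x = y.
    by have [dP _ _] := hd; apply/dP/eqP; rewrite -leqn0 -D0.
  by rewrite leeDl// lee_fin ltW.
have [cQ _ _] := hQ.
have Q0 := coupling_ge0 cQ.
have Sclosed z z' : S z -> Q z z' != 0 -> gap d z' = gap d z -> S z'.
  by move=> Sz; exact: (transition_stays (hXY z) Sz (hstay z)).
have hgap z : S z -> (0 < gap d z)%N by exact: (gap_gt0 hd hS).
have hsurv z : S z -> (survival Q (gap d) k z <= (1 - p)%:E)%E.
  by move=> Sz; apply: (survival_le Q0 (hXY z)); exact: hi.
have hjump n z : S z ->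
    (jump Q (gap d) n z <= (alpha * (gap d z)%:R)%:E)%E.
  move=> Sz; apply: (jump_le Q0 (hXY z)).
  - exact: ltW.
  - exact: hgap.
  - exact: hii.
have p1 : p <= 1.
  have [[s [s_path s_last] s_len] _] := hdS x1 y1.
  case: s s_path s_last s_len => [_ _|u s /= /andP[]].
    by rewrite d_max => D0; rewrite -D0 in D_gt0.
  rewrite inE => Sxu _ _ _; have := survival_ge0 (gap d) Q0 k (x1, u).
  by move=> /le_trans /(_ (hsurv _ Sxu)); rewrite lee_fin subr_ge0.
have b0 : 0 < 1 - alpha by rewrite subr_gt0.
have DR0 : 0 < D%:R :> R by rewrite ltr0n.
have b1 : 1 - alpha <= 1 by rewrite lerBlDr lerDl ltW.
have [j jb j_le] := exp_decay_le hp p1 b0 b1.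
have rate_gt0 : 0 < p * (1 - alpha) by rewrite mulr_gt0.
have rate_le1 : p * (1 - alpha) <= 1.
  by rewrite mulr_ile1 ?(ltW hp) ?(ltW b0).
have ratio_gt0 : 0 < eps / D%:R by rewrite divr_gt0.
have ratio_le1 : eps / D%:R <= 1.
  by rewrite ler_pdivrMr// mul1r (le_trans (ltW heps1))// ler1n.
have [n nb n_le] := exp_decay_le rate_gt0 rate_le1 ratio_gt0 ratio_le1.
exists ((n + j) * k)%N; last first.
  by apply: duration_le j_le n_le => //; exact: ltW.
apply: mixed_of_oscillation => // g g0 g1 x y.
apply: (le_trans (oscillation_decay hP hd hdS cQ Sclosed hS (ltW hp) p1
  (ltW halpha0) halpha1 hsurv hjump n jb g0 g1 x y)).
rewrite leeD2l// lee_fin; apply: (@le_trans _ _ (eps / D%:R * D%:R)).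
  apply: ler_pM => //; last by rewrite ler_nat.
  by rewrite exprn_ge0// subr_ge0.
by rewrite divfK ?gt_eqF.
Qed.
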